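(* Let $K\ge 2$ and let $(A_k)_{k=0,\dots,K-2}$ be a basis of the space $P^{K-2}$ of univariate real polynomials of degree at most $K-2$. For $i\in\mathbb Z$ and $k\in\{0,\dots,K-2\}$ the biorthogonal test function associated to the $k$-th moment in cell $i$ is $$\psi_i^{(k)}(x) = A_k(x-x_i)\,\mathbb 1_{[x_{i-\frac12},x_{i+\frac12}]}(x).$$ That is, these functions satisfy, for all $i,j\in\mathbb Z$ and all $k,\ell\in\{0,\dots,K-2\}$, $$(\psi^{(\ell)}_j,\phi_{i+\frac12})_{L^2}=0,\qquad (\psi^{(\ell)}_j,\phi_i^{(k)})_{L^2}=\delta_{k\ell}\,\delta_{ij},$$ where $\phi_{i+\frac12}$ and $\phi_i^{(k)}$ are the global Active Flux basis functions.
   Context: Grid: $\Delta x>0$, interfaces $x_{i+\frac12}$ ($i\in\mathbb Z$) with $x_{i+\frac12}-x_{i-\frac12}=\Delta x$, and cell centres $x_i=\frac12(x_{i-\frac12}+x_{i+\frac12})$. $\mathbb 1_I$ is the characteristic function of the set $I$, and $(u,v)_{L^2}=\int_{\mathbb R}u(x)v(x)\,\mathrm dx$. Local element: let $E=[-\frac{\Delta x}2,\frac{\Delta x}2]$ and $V=P^K(E)$ (polynomials of degree at most $K$ on $E$). The degrees of freedom are the linear functionals on $V$ $$\sigma_{\pm\frac12}(v)=v\left(\pm\tfrac{\Delta x}{2}\right),\qquad \sigma_k(v)=\int_E A_k(x)v(x)\,\mathrm dx,\quad k=0,\dots,K-2.$$ The local basis $\{B_{-\frac12},B_{+\frac12},B_0,\dots,B_{K-2}\}$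 of $V$ is the dual one: $\sigma_r(B_s)=\delta_{rs}$ for all $r,s\in\{\pm\frac12,0,1,\dots,K-2\}$ (the index $0,1,\dots,K-2$ refers to moments, the indices $\pm\frac12$ to point values). Global basis functions: $$\phi_i^{(k)}(x)=B_k(x-x_i)\,\mathbb 1_{[x_{i-\frac12},x_{i+\frac12}]}(x),$$ $$\phi_{i+\frac12}(x)=B_{+\frac12}(x-x_i)\,\mathbb 1_{[x_{i-\frac12},x_{i+\frac12})}(x)+B_{-\frac12}(x-x_{i+1})\,\mathbb 1_{[x_{i+\frac12},x_{i+\frac32}]}(x).$$ *)

(* Defs.v *)
From mathcomp Require Import all_boot all_order all_algebra.
From mathcomp Require Import all_classical all_reals all_analysis.

Set Implicit Arguments.
Unset Strict Implicit.
Unset Printing Implicit Defensive.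

Import Order.TTheory GRing.Theory Num.Theory.
Import numFieldNormedType.Exports.

Local Open Scope classical_set_scope.
Local Open Scope ring_scope.

(* [{poly_n R}] consists of the polynomials of size at most n, that is, of
   degree at most n - 1: P^{K-2} is [{poly_(K.-1) R}] (for K >= 2) and
   V = P^K(E) is [{poly_(K.+1) R}], polynomials on E being identified with
   formal polynomials because E is infinite. *)

(* Index set {-1/2, +1/2} + {0, ..., K-2} of the degrees of freedom:
   [inl false] is -1/2, [inl true] is +1/2, [inr k] is the k-th moment. *)
Definition dof (K : nat) : finType := (bool + 'I_K.-1)%type.

Section ActiveFlux.
Context (R : realType) (K : nat).

Definition E (dx : R) : set R := `[- (dx / 2), dx / 2].

Definition sigma (dx : R) (A : 'I_K.-1 -> {poly_(K.-1) R}) (r : dof K)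
    (v : {poly_(K.+1) R}) : R :=
  match r with
  | inl false => v.[- (dx / 2)]
  | inl true => v.[dx / 2]
  | inr k => \int[lebesgue_measure]_(x in E dx) ((A k).[x] * v.[x])
  end.

Definition is_dual_basis (dx : R) (A : 'I_K.-1 -> {poly_(K.-1) R})
    (B : dof K -> {poly_(K.+1) R}) : Prop :=
  basis_of fullv (codom B) /\
  forall r s : dof K, sigma dx A r (B s) = (r == s)%:R.

(* [xf i] stands for the interface x_{i+1/2}; thus x_{i-1/2} is [xf (i - 1)]. *)
Definition uniform_grid (dx : R) (xf : int -> R) : Prop :=
  forall i : int, xf i - xf (i - 1) = dx.

Definition center (xf : int -> R) (i : int) : R := (xf (i - 1) + xf i) / 2.

Definition phi_moment (xf : int -> R) (B : dof K -> {poly_(K.+1) R})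
    (i : int) (k : 'I_K.-1) (x : R) : R :=
  (B (inr k)).[x - center xf i] * \1_(`[xf (i - 1), xf i]) x.

(* phi_{i+1/2} *)
Definition phi_point (xf : int -> R) (B : dof K -> {poly_(K.+1) R})
    (i : int) (x : R) : R :=
  (B (inl true)).[x - center xf i] * \1_(`[xf (i - 1), xf i[) x +
  (B (inl false)).[x - center xf (i + 1)] * \1_(`[xf i, xf (i + 1)]) x.

Definition psi (xf : int -> R) (A : 'I_K.-1 -> {poly_(K.-1) R})
    (i : int) (k : 'I_K.-1) (x : R) : R :=
  (A k).[x - center xf i] * \1_(`[xf (i - 1), xf i]) x.

(* Extended-real valued, so that an equation with a real right-hand side also
   says that the integral is finite. *)
Definition L2prod (u v : R -> R) : \bar R :=
  (\int[lebesgue_measure]_x (u x * v x)%:E)%E.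

End ActiveFlux.

(* Main.v *)
Require Import Defs.
From mathcomp Require Import all_boot all_order all_algebra.
From mathcomp Require Import all_classical all_reals all_analysis.
From mathcomp Require Import measurable_realfun.
From mathcomp Require Import zify ring lra.

Set Implicit Arguments.
Unset Strict Implicit.
Unset Printing Implicit Defensive.

Import Order.TTheory GRing.Theory Num.Theory.
Import numFieldNormedType.Exports.

Local Open Scope classical_set_scope.
Local Open Scope ring_scope.

(** The interfaces increase strictly, so distinct closed cells share at most one
    interface, which is a null set. The test function psi_j^(l) vanishes outside
    the j-th cell; hence in a product with a global basis function u only the
    values of u in the open j-th cell matter, and there u coincides with
    v(x - x_j) for some v in P^K (a local basis polynomial, or 0). After
    translating the cell onto E this gives (psi_j^(l), u) = sigma_l(v)
    ([L2prod_psi]). By [indic_cell], the polynomial v is B_k for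
    u = phi_i^(k) with i = j, it is B_{+1/2} or B_{-1/2} for u = phi_{i+1/2}
    with i = j or i + 1 = j, and it is 0 in all other cases; the duality
    sigma_r(B_s) = delta_{rs} concludes. *)

Section Grid.
Context (R : realType) (dx : R) (xf : int -> R).
Context (hdx : 0 < dx) (hxf : uniform_grid dx xf).

Lemma uniform_gridE (i : int) : xf i = xf 0 + dx * i%:~R.
Proof.
elim/int_ind: i => [|n IH|n IH]; first by rewrite mulr0 addr0.
- have := hxf n.+1%:Z; rewrite -addn1 PoszD addrK IH intrD => /eqP.
  by rewrite subr_eq => /eqP ->; ring.
- have := hxf (- n%:Z); rewrite IH => h.
  have -> : - n.+1%:Z = - n%:Z - 1 by lia.
  by rewrite intrB mulrBr mulr1; lra.
Qed.

Lemma uniform_grid_le (i j : int) : (xf i <= xf j) = (i <= j).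
Proof. by rewrite (uniform_gridE i) (uniform_gridE j) lerD2l ler_pM2l// ler_int. Qed.

Lemma uniform_grid_lt (i j : int) : (xf i < xf j) = (i < j).
Proof. by rewrite !ltNge uniform_grid_le. Qed.

Lemma left_interfaceE (i : int) : xf (i - 1) = - (dx / 2) + Defs.center xf i.
Proof. by rewrite /Defs.center -(hxf i); field. Qed.

Lemma right_interfaceE (i : int) : xf i = dx / 2 + Defs.center xf i.
Proof. by rewrite /Defs.center -(hxf i); field. Qed.

(** Whether the i-th cell is taken open, half-open or closed does not matter on
    the open j-th cell. *)
Lemma indic_cell (i j : int) (I : set R) (x : R) :
  `]xf (i - 1), xf i[ `<=` I -> I `<=` `[xf (i - 1), xf i] ->
  x \in `]xf (j - 1), xf j[ -> \1_I x = (i == j)%:R :> R.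
Proof.
move=> openI Iclosed xj; rewrite indicE; congr (_%:R).
have [ij|ij] := eqVneq i j; first by rewrite mem_set//; apply: openI; rewrite ij.
move: xj; rewrite in_itv/= => /andP[jx xj].
rewrite memNset// => /Iclosed/=; rewrite in_itv/= => /andP[ix xi].
(* the cells overlap in x: x_{i-1/2} < x_{j+1/2} and x_{j-1/2} < x_{i+1/2} *)
have := le_lt_trans ix xj; have := lt_le_trans jx xi.
rewrite !uniform_grid_lt => ? ?; move: ij; lia.
Qed.

End Grid.

Section Integrals.
Context (R : realType).
Implicit Types (a b c : R) (p : {poly R}) (f : R -> R).
Let mu := @lebesgue_measure R.

Lemma continuous_horner_center c p : continuous (fun x : R => p.[x - c]).
Proof.
move=> x; apply: (@continuous_comp _ _ _ (fun x => x - c) (horner p)).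
  by apply: cvgB; [exact: cvg_id|exact: cvg_cst].
exact: continuous_horner.
Qed.

Lemma integrable_horner a b p :
  mu.-integrable `[a, b] (fun x => (p.[x])%:E).
Proof.
apply: (@continuous_compact_integrable _ (horner p)); first exact: segment_compact.
by apply: continuous_subspaceT => x; exact: continuous_horner.
Qed.

(** The values of [f] at the two endpoints are unconstrained; no measurability
    of [f] is assumed, since on the open interval it agrees with [g]. *)
Lemma integral_eq_in_itvoo f (g : R -> R) a b : measurable_fun setT g ->
  (forall x, x \notin `[a, b] -> f x = 0) -> {in `]a, b[, f =1 g} ->
  (\int[mu]_x (f x)%:E = \int[mu]_(x in `[a, b]) (g x)%:E)%E.
Proof.
move=> mg f0 fg.
have mge : measurable_fun `]a, b[ (EFin \o g).
  by apply/measurable_EFinP; exact: measurable_funTS.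
transitivity (\int[mu]_(x in `[a, b]) (f x)%:E)%E.
  rewrite [RHS]integral_mkcond; apply: eq_integral => x _.
  by rewrite patchE; case: ifPn => //; rewrite mem_setE => /f0 ->.
have mfe : measurable_fun `]a, b[ (EFin \o f).
  apply: eq_measurable_fun mge => x; rewrite mem_setE => xab /=.
  by rewrite fg.
rewrite [LHS](integral_itv_bndoo _ _ mfe) [RHS](integral_itv_bndoo _ _ mge).
by apply: eq_integral => x; rewrite mem_setE => xab; rewrite /= fg.
Qed.

Lemma integral_horner_shift a b c p : a <= b ->
  (\int[mu]_(x in `[(a + c)%R, (b + c)%R]) (p.[x - c])%:E =
   \int[mu]_(x in `[a, b]) (p.[x])%:E)%E.
Proof.
move=> ab.
have dF : derive1 (fun x : R => x + c) = cst 1.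
  by apply/funext => x; rewrite derive1E derive_val addr0.
rewrite (@integration_by_substitution_increasing _ (fun x => x + c)
  (fun x => p.[x - c]))//.
- apply: eq_integral => x _ /=.
  by rewrite !fctE dF/= addrK mulr1.
- by move=> x y _ _ xy; rewrite ltrD2r.
- by rewrite dF => x _; exact: cst_continuous.
- by rewrite dF; exact: is_cvg_cst.
- by rewrite dF; exact: is_cvg_cst.
- have cF : continuous (fun x : R => x + c).
    by move=> x; apply: cvgD; [exact: cvg_id|exact: cvg_cst].
  split=> [x _| |]; first by apply: ex_derive.
  + by apply: cvg_at_right_filter; exact: cF.
  + by apply: cvg_at_left_filter; exact: cF.
- by apply: continuous_subspaceT; exact: continuous_horner_center.
Qed.

End Integrals.

(** Testing against psi_j^(l) evaluates the l-th moment of the local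
    representative [v] of [u] in the j-th cell. *)
Lemma L2prod_psi (R : realType) (K : nat) (dx : R) (xf : int -> R)
    (A : 'I_K.-1 -> {poly_(K.-1) R}) (j : int) (l : 'I_K.-1)
    (u : R -> R) (v : {poly_(K.+1) R}) :
  0 < dx -> uniform_grid dx xf ->
  {in `]xf (j - 1), xf j[, forall x, u x = v.[x - Defs.center xf j]} ->
  L2prod (psi xf A j l) u = (sigma dx A (inr l) v)%:E.
Proof.
move=> hdx hxf uv; rewrite /L2prod /sigma /Rintegral.
pose p : {poly R} := (A l : {poly R}) * v.
rewrite (@integral_eq_in_itvoo _ _ (fun x => p.[x - Defs.center xf j])
    (xf (j - 1)) (xf j)).
- rewrite (left_interfaceE hxf) (right_interfaceE hxf).
  rewrite integral_horner_shift; last by lra.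
  (* the moment is a real-valued integral: it must be seen to be finite *)
  rewrite fineK; last first.
    rewrite /E; under eq_integral do rewrite -hornerM.
    by apply: integrable_fin_num => //; exact: integrable_horner.
  by apply: eq_integral => x _; rewrite hornerM.
- by apply: continuous_measurable_fun; exact: continuous_horner_center.
- by move=> x xj; rewrite /psi indicE memNset ?mulr0 ?mul0r//=; exact/negP.
- move=> x xj; rewrite /psi (indic_cell (i := j) hdx hxf _ _ xj)// ?eqxx ?mulr1.
    by rewrite uv// hornerM.
  exact: subset_itv_oo_cc.
Qed.

Lemma sigma_moment0 (R : realType) (K : nat) (dx : R)
    (A : 'I_K.-1 -> {poly_(K.-1) R}) (l : 'I_K.-1) :
  sigma dx A (inr l) 0 = 0.
Proof.
rewrite /sigma /Rintegral; under eq_integral do rewrite horner0 mulr0.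
by rewrite integral0.
Qed.

Theorem theorem2p1 (R : realType) (K : nat) (hK : (2 <= K)%N)
    (dx : R) (hdx : 0 < dx) (xf : int -> R) (hxf : uniform_grid dx xf)
    (A : 'I_K.-1 -> {poly_(K.-1) R}) (hA : basis_of fullv (codom A))
    (B : dof K -> {poly_(K.+1) R}) (hB : is_dual_basis dx A B) :
  (forall (i j : int) (l : 'I_K.-1),
      L2prod (psi xf A j l) (phi_point xf B i) = 0%:E) /\
  (forall (i j : int) (k l : 'I_K.-1),
      L2prod (psi xf A j l) (phi_moment xf B i k) =
        ((k == l)%:R * (i == j)%:R)%:E).
Proof.
have [_ dual] := hB.
split=> [i j l|i j k l].
- have uE x : x \in `]xf (j - 1), xf j[ -> phi_point xf B i x =
      (B (inl true)).[x - Defs.center xf i] * (i == j)%:R +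
      (B (inl false)).[x - Defs.center xf (i + 1)] * (i + 1 == j)%:R.
    move=> xj; rewrite /phi_point.
    rewrite (indic_cell (i := i) hdx hxf _ _ xj); last 2 first.
    + exact: subset_itv_oo_co.
    + exact: subset_itv_co_cc.
    rewrite (indic_cell (i := i + 1) hdx hxf _ _ xj) ?addrK//.
    exact: subset_itv_oo_cc.
  have [ij|ij] := eqVneq i j.
    rewrite (@L2prod_psi _ _ dx _ _ _ _ _ (B (inl true)))// ?dual// => x xj.
    have ij1 : (i + 1 == j) = false by lia.
    by rewrite uE// ij1 -ij eqxx mulr1 mulr0 addr0.
  have [ij1|ij1] := eqVneq (i + 1) j.
    rewrite (@L2prod_psi _ _ dx _ _ _ _ _ (B (inl false)))// ?dual// => x xj.
    by rewrite uE// (negPf ij) -ij1 eqxx mulr0 add0r mulr1.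
  rewrite (@L2prod_psi _ _ dx _ _ _ _ _ 0)// ?sigma_moment0// => x xj.
  by rewrite uE// (negPf ij) (negPf ij1) !mulr0 addr0 horner0.
- have uE x : x \in `]xf (j - 1), xf j[ -> phi_moment xf B i k x =
      (B (inr k)).[x - Defs.center xf i] * (i == j)%:R.
    move=> xj; rewrite /phi_moment (indic_cell (i := i) hdx hxf _ _ xj)//.
    exact: subset_itv_oo_cc.
  have [ij|ij] := eqVneq i j.
    rewrite (@L2prod_psi _ _ dx _ _ _ _ _ (B (inr k)))//.
      by rewrite dual mulr1 eq_sym.
    by move=> x xj; rewrite uE// -ij eqxx mulr1.
  rewrite (@L2prod_psi _ _ dx _ _ _ _ _ 0)// ?sigma_moment0 ?mulr0// => x xj.
  by rewrite uE// (negPf ij) mulr0 horner0.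
Qed.
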